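(* Let $\Gamma$ be a two-ended highly-arc-transitive digraph of prime out-valency $p$ such that $m>2$, where $m$ is the common cardinality of the fibres $\varphi^{-1}(i)$, $i\in\mathbb Z$, of a surjective digraph homomorphism $\varphi:\Gamma\to\vec{\mathbb Z}$. Then $\Gamma$ is isomorphic to $\mathrm{Pl}^r(\Delta_p)$, where $r$ is such that $p^{r+1}=m$.
   Context: A digraph $\Gamma=(V\Gamma,E\Gamma)$ has vertex set $V\Gamma$ and arc set $E\Gamma\subseteq V\Gamma\times V\Gamma$. It is connected if its underlying undirected graph is connected. ''Out-valency $p$'' means that every vertex $v$ has exactly $p$ out-neighbours (vertices $u$ with $(v,u)\in E\Gamma$). A $k$-arc is a sequence of vertices $v_0,\dots,v_k$ with $(v_i,v_{i+1})\in E\Gamma$ for $0\le i<k$ (a 0-arc is a vertex). $\Gamma$ is highly-arc-transitive if $\mathrm{Aut}(\Gamma)$ is transitive on the $k$-arcs for all $k$. A ray is a one-way infinite path (in the underlying undirected graph) with distinct vertices. The ends of a digraph are the equivalence classes of rays, where two rays are equivalent if there is an infinite family of pairwise disjoint paths (ignoring directions) each having its initial vertex in one ray and terminal vertex in the other. A digraph is two-ended if it is connected and has exactly two ends. $\vec{\mathbb Z}$ is the digraph with vertex set $\mathbb Z$ and arcs $(i,i+1)$, $i\in\mathbb Z$; a digraph homomorphism is a map on vertices sending arcs to arcs (preserving direction). Every two-ended highly-arc-transitive digraph of positive out-valency admits a surjective digraph homomorphism $\varphi:\Gamma\to\vec{\mathbb Z}$, unique up to adding an integer constant, and its fibres are finite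 and all of the same size $m$. The partial line graph (line digraph) $\mathrm{Pl}(\Gamma)$ has the arcs of $\Gamma$ as vertices, and $((x,y),(w,z))$ is an arc of $\mathrm{Pl}(\Gamma)$ iff $y=w$. $\mathrm{Pl}^r(\Gamma)$ is obtained by applying this operation $r$ times successively ($\mathrm{Pl}^0(\Gamma)=\Gamma$). $\Delta_p$ is the digraph with vertex set $\mathbb Z\times\mathbb Z_p$ and arcs $((i,x),(i+1,y))$ for all $i\in\mathbb Z$ and $x,y\in\mathbb Z_p$. *)

(* Defs.v *)
From mathcomp Require Import all_boot all_order all_algebra.
From mathcomp Require Import all_classical.

Set Implicit Arguments.
Unset Strict Implicit.
Unset Printing Implicit Defensive.

Local Open Scope classical_set_scope.
Local Open Scope card_scope.

(* Loops are allowed; parallel arcs are not. *)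
Record digraph := Digraph { vertex :> Type; arc : vertex -> vertex -> Prop }.

Definition is_hom (G H : digraph) (f : G -> H) : Prop :=
  forall x y : G, arc x y -> arc (f x) (f y).

Definition is_iso (G H : digraph) (f : G -> H) : Prop :=
  bijective f /\ forall x y : G, arc x y <-> arc (f x) (f y).

Definition isomorphic (G H : digraph) : Prop :=
  exists f : G -> H, is_iso f.

Definition is_automorphism (G : digraph) (g : G -> G) : Prop := is_iso g.

Definition out_valency (G : digraph) (p : nat) : Prop :=
  forall v : G, [set u : G | arc v u] #= `I_p.

(* A finite sequence v_0, ..., v_k is encoded by a function on nat of which
   only the values at 0, ..., k are ever considered. *)
Definition karc (G : digraph) (k : nat) (v : nat -> G) : Prop :=
  forall i, i < k -> arc (v i) (v i.+1).

Definition highly_arc_transitive (G : digraph) : Prop :=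
  forall (k : nat) (v w : nat -> G), karc k v -> karc k w ->
  exists2 g : G -> G, is_automorphism g & forall i, i <= k -> g (v i) = w i.

Definition adjacent (G : digraph) (x y : G) : Prop := arc x y \/ arc y x.

(* The undirected path w_0, ..., w_n, encoded as for karc. *)
Definition is_path (G : digraph) (n : nat) (w : nat -> G) : Prop :=
  (forall i, i < n -> adjacent (w i) (w i.+1)) /\
  (forall i j, i <= n -> j <= n -> w i = w j -> i = j).

Definition connected (G : digraph) : Prop :=
  forall x y : G, exists (n : nat) (w : nat -> G),
    [/\ is_path n w, w 0 = x & w n = y].

Definition is_ray (G : digraph) (r : nat -> G) : Prop :=
  (forall i, adjacent (r i) (r i.+1)) /\ injective r.

(* The k-th path of the family is P k 0, ..., P k (len k); it may consist of
   a single vertex common to both rays. *)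
Definition ray_equiv (G : digraph) (r s : nat -> G) : Prop :=
  exists (len : nat -> nat) (P : nat -> nat -> G),
    [/\ forall k, is_path (len k) (P k),
        forall k l, k <> l -> forall i j, i <= len k -> j <= len l ->
          P k i <> P l j,
        forall k, exists a, P k 0 = r a &
        forall k, exists b, P k (len k) = s b].

Definition ends (G : digraph) : set (set (nat -> G)) :=
  [set C | exists2 r : nat -> G, is_ray r &
           C = [set s | is_ray s /\ ray_equiv r s]].
Arguments ends : clear implicits.

Definition two_ended (G : digraph) : Prop := connected G /\ ends G #= `I_2.

Definition vecZ : digraph :=
  @Digraph int (fun i j => j = (i + 1)%R).

Definition Pl (G : digraph) : digraph :=
  @Digraph {a : G * G | arc a.1 a.2} (fun a b => (sval a).2 = (sval b).1).

(* Only the underlying set of Z_p matters, so 'I_p is used: it has p elements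
   for every p, whereas 'Z_p does not for p < 2. *)
Definition Delta (p : nat) : digraph :=
  @Digraph (int * 'I_p) (fun a b => b.1 = (a.1 + 1)%R).

(* Main.v *)
Require Import Defs.
From mathcomp Require Import all_boot all_order all_algebra.
From mathcomp Require Import all_fingroup all_solvable.
From mathcomp Require Import boolp.

Set Implicit Arguments.
Unset Strict Implicit.
Unset Printing Implicit Defensive.

(* Since fibres are finite, the in-valency is p as well, and the number of
   vertices reached from v in k steps grows as p^k until, by connectedness, it
   fills a whole fibre; hence m = p^b, and there is exactly one directed path of
   length b from any vertex of fibre i to any vertex of fibre i + b.

   The key point is that two vertices with a common out-neighbour have the same
   out-neighbours. Take a Sylow p-subgroup P of the (finite) group induced, on
   finitely many fibres, by the automorphisms that fix a directed path of length
   2b - 1. By high arc-transitivity P moves the out-neighbours of its last vertex.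
   If P fixes x and one of its p out-neighbours, it fixes all of them; combined
   with the uniqueness of paths of length b, this shows that P fixes all of the
   b-th fibre. In the first later fibre not fixed by P, an orbit of P is the whole
   out-neighbourhood of each of its in-neighbours.

   If b = 1 then the digraph is Delta_p. Otherwise identifying vertices with the
   same out-neighbours gives a digraph with the same properties and fibres of
   size m / p, whose partial line graph is the given digraph; conclude by
   induction on m. *)

(** * Digraphs layered over the integers *)

Definition succ (i : int) : int := (i + 1)%R.

(* [A i x y] is the arc from vertex [x] of level [i] to vertex [y] of level
   [i + 1]. *)
Definition layers (m : nat) := int -> rel 'I_m.

(** Levels are written [iter t succ i] so that each is definitionally the [succ] of the one
    before. *)
Definition is_arc m (A : layers m) (k : nat) (i : int) (v : nat -> 'I_m) :=
  forall t, t < k -> A (iter t succ i) (v t) (v t.+1).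

(** Commuting with [succ] makes [tau] a translation. Injectivity of [sg i] amounts to bijectivity,
    levels being finite of equal size. *)
Definition layer_aut m (A : layers m) (tau : int -> int)
    (sg : int -> 'I_m -> 'I_m) :=
  [/\ forall i, tau (succ i) = succ (tau i),
      forall i, injective (sg i) &
      forall i x y, A (tau i) (sg i x) (sg (succ i) y) = A i x y].

Definition layer_hat m (A : layers m) :=
  forall k i j v w, is_arc A k i v -> is_arc A k j w ->
  exists tau sg, [/\ layer_aut A tau sg, tau i = j &
    forall t, t <= k -> sg (iter t succ i) (v t) = w t].

(** Connectedness without paths: the sets [U] are the unions of components. *)
Definition layer_connected m (A : layers m) :=
  forall U : int -> {set 'I_m},
  (forall i x y, A i x y -> (x \in U i) = (y \in U (succ i))) ->
  (exists i x, x \in U i) -> forall i x, x \in U i.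

Definition outn m (A : layers m) i x := [set y | A i x y].

Fixpoint desc m (A : layers m) k i x : {set 'I_m} :=
  if k is k'.+1 then \bigcup_(y in outn A i x) desc A k' (succ i) y
  else [set x].

(** * Descendants in a layered digraph *)

Section Desc.
Context (m : nat) (A : layers m).

Lemma desc1 i x : desc A 1 i x = outn A i x.
Proof.
apply/setP=> y; apply/bigcupP/idP => [[z zx]|yx].
  by rewrite inE => /eqP->.
by exists y => //; rewrite inE.
Qed.

Lemma descS k i x :
  desc A k.+1 i x = \bigcup_(y in outn A i x) desc A k (succ i) y.
Proof. by []. Qed.

Lemma desc_sub k i x y : A i x y -> desc A k (succ i) y \subset desc A k.+1 i x.
Proof. by move=> xy; apply: bigcup_sup; rewrite inE. Qed.

(** The definition splits off the first arc; counting level by level needs the last one split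
    off. *)
Lemma descSr k i x :
  desc A k.+1 i x = \bigcup_(y in desc A k i x) outn A (iter k succ i) y.
Proof.
elim: k i x => [|k IH] i x; first by rewrite desc1 /= big_set1.
rewrite [LHS]/=; apply/setP=> z; apply/bigcupP/bigcupP.
  move=> [y xy]; rewrite -[_ \in _]/(z \in desc A k.+1 (succ i) y) IH.
  case/bigcupP=> u yu uz; exists u; last by rewrite iterSr.
  by apply/bigcupP; exists y.
move=> [u /bigcupP[y xy yu]]; rewrite iterSr => uz; exists y => //.
by rewrite -[_ \in _]/(z \in desc A k.+1 (succ i) y) IH; apply/bigcupP; exists u.
Qed.

Lemma desc_path k i x z : z \in desc A k i x ->
  exists v, [/\ is_arc A k i v, v 0 = x & v k = z].
Proof.
elim: k i x => [|k IH] i x; first by rewrite inE => /eqP->; exists (fun=> x).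
case/bigcupP=> y; rewrite inE => xy /IH[v [av v0 vk]].
exists (fun t => if t is t'.+1 then v t' else x); split=> // [[|t]] tk.
  by rewrite /= v0.
by rewrite iterSr; apply: av.
Qed.

Lemma layer_aut_iter tau sg k i :
  layer_aut A tau sg -> tau (iter k succ i) = iter k succ (tau i).
Proof. by case=> tS _ _; elim: k => //= k <-. Qed.

Lemma layer_aut_surj tau sg i y : layer_aut A tau sg -> exists x, y = sg i x.
Proof. by case=> _ /(_ i)/injF_bij[f _ gK] _; exists (f y). Qed.

Lemma outn_aut tau sg i x : layer_aut A tau sg ->
  outn A (tau i) (sg i x) = sg (succ i) @: outn A i x.
Proof.
move=> aut; apply/setP=> y.
have [z ->] := layer_aut_surj (succ i) y aut; have [_ inj AE] := aut.
by rewrite mem_imset // !inE AE.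
Qed.

Lemma desc_aut tau sg k i x : layer_aut A tau sg ->
  desc A k (tau i) (sg i x) = sg (iter k succ i) @: desc A k i x.
Proof.
move=> aut; elim: k => [|k IH]; first by rewrite /= imset_set1.
have [_ inj _] := aut.
rewrite !descSr IH -(layer_aut_iter _ _ aut); apply/setP=> z.
apply/bigcupP/imsetP.
  move=> [_ /imsetP[y yx ->]]; rewrite outn_aut // => /imsetP[u yu ->].
  by exists u => //; apply/bigcupP; exists y.
move=> [u /bigcupP[y yx yu] ->]; exists (sg (iter k succ i) y).
  exact: imset_f.
by rewrite outn_aut // imset_f.
Qed.

Lemma layer_aut_comp t1 s1 t2 s2 : layer_aut A t1 s1 -> layer_aut A t2 s2 ->
  layer_aut A (t2 \o t1) (fun i => s2 (t1 i) \o s1 i).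
Proof.
move=> [tS1 inj1 A1] [tS2 inj2 A2]; split=> [i|i x y /inj2/inj1 //|i x y] /=.
  by rewrite tS1 tS2.
by rewrite tS1 A2 A1.
Qed.

Hypothesis hat : layer_hat A.

(** Choose arcs from [x] to [z] and to [z']; an automorphism taking one to the other fixes their
    common start. *)
Lemma desc_trans k i x z z' : z \in desc A k i x -> z' \in desc A k i x ->
  exists tau sg, [/\ layer_aut A tau sg, tau i = i, sg i x = x &
    sg (iter k succ i) z = z'].
Proof.
move=> /desc_path[v [av v0 vk]] /desc_path[w [aw w0 wk]].
have [tau [sg [aut ti E]]] := hat av aw; exists tau, sg; split=> //.
  by rewrite -{1}v0 -w0; apply: (E 0).
by rewrite -vk -wk E.
Qed.

Lemma vertex_trans i x j y :
  exists tau sg, [/\ layer_aut A tau sg, tau i = j & sg i x = y].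
Proof.
have av z l : is_arc A 0 l (fun=> z) by [].
have [tau [sg [aut ti E]]] := hat (av x i) (av y j); exists tau, sg.
by split=> //; apply: (E 0).
Qed.

Lemma card_desc k i x j y : #|desc A k i x| = #|desc A k j y|.
Proof.
have [tau [sg [aut <- <-]]] := vertex_trans i x j y.
by rewrite desc_aut // card_imset //; case: aut.
Qed.

End Desc.

(** * Counting descendants *)

Section Growth.
Context (m p : nat) (A : layers m).
Hypotheses (hat : layer_hat A) (out : forall i x, #|outn A i x| = p).
Hypotheses (p_prime : prime p) (m_gt0 : 0 < m).

Definition inn i (y : 'I_m) := [set x | A i x y].

(** Transitivity makes the in-valency constant on a level; double counting the arcs between two
    levels of equal size gives [p]. *)
Lemma card_inn i y : #|inn i y| = p.
Proof.
have E z : #|inn i z| = #|inn i y|.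
  have [tau [sg [aut ti <-]]] := vertex_trans hat (succ i) z (succ i) y.
  have tii : tau i = i.
    case: (aut) => tS _ _; move: ti; rewrite tS /succ => /GRing.addIr //.
  have -> : inn i (sg (succ i) z) = sg i @: inn i z.
    apply/setP=> x; have [w ->] := layer_aut_surj i x aut.
    case: aut => _ inj AE; rewrite mem_imset // !inE.
    by rewrite -{1}tii AE.
  by rewrite card_imset //; case: aut.
have : \sum_(z : 'I_m) #|inn i z| = \sum_(x : 'I_m) #|outn A i x|.
  under eq_bigr do rewrite -sum1_card.
  under [RHS]eq_bigr do rewrite -sum1_card.
  rewrite (exchange_big_dep predT) //=.
  by apply: eq_bigr => x _; apply: eq_bigl => z; rewrite !inE.
rewrite (eq_bigr (fun=> #|inn i y|)) // [RHS](eq_bigr (fun=> p)) //.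
by rewrite !sum_nat_const card_ord => /eqP; rewrite eqn_pmul2l // => /eqP.
Qed.

(* Each vertex of [desc k.+1] has the same number [c <= p] of in-neighbours in
   [desc k], so [p * #|desc k| = c * #|desc k.+1|]. *)
Lemma desc_growth k i x : #|desc A k i x| = p ^ k ->
  #|desc A k.+1 i x| = p ^ k.+1 \/ #|desc A k.+1 i x| = p ^ k.
Proof.
move=> ck; set D := desc A k i x; set D' := desc A k.+1 i x.
set c := fun z => #|inn (iter k succ i) z :&: D|.
have p_gt0 := prime_gt0 p_prime.
have cE z z' : z \in D' -> z' \in D' -> c z = c z'.
  move=> zD z'D; have [tau [sg [aut ti sx <-]]] := desc_trans hat zD z'D.
  have ti' := layer_aut_iter k i aut; rewrite ti in ti'.
  have DE : D = sg (iter k succ i) @: D.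
    by rewrite -(desc_aut k i x aut) ti sx.
  rewrite /c {2}DE.
  have -> : inn (iter k succ i) (sg (iter k.+1 succ i) z)
          = sg (iter k succ i) @: inn (iter k succ i) z.
    apply/setP=> u; have [w ->] := layer_aut_surj (iter k succ i) u aut.
    case: aut => _ inj AE; rewrite mem_imset // !inE.
    by rewrite -{1}ti' AE.
  rewrite -imsetI ?card_imset //; last by move=> ? ? _ _; case: aut => _ + _; apply.
  by case: aut.
have S : \sum_(z in D') c z = p ^ k.+1.
  rewrite expnSr -ck -sum_nat_const.
  transitivity (\sum_(y in D) #|outn A (iter k succ i) y|); last first.
    by apply: eq_bigr.
  rewrite /c; under eq_bigr do rewrite -sum1_card.
  under [RHS]eq_bigr do rewrite -sum1_card.
  rewrite (exchange_big_dep (mem D)) /=; last first.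
    by move=> z y _; rewrite inE => /andP[].
  apply: eq_bigr => y yD; apply: eq_bigl => z.
  rewrite !inE yD andbT andb_idl // => yz.
  by rewrite /D' descSr; apply/bigcupP; exists y => //; rewrite inE.
have [z zD'] : exists z, z \in D'.
  apply/set0Pn; apply/negP=> /eqP D0; move: S; rewrite D0 big_set0 => /esym/eqP.
  by rewrite expn_eq0 eqn0Ngt p_gt0.
have {}S : #|D'| * c z = p ^ k.+1.
  by rewrite -S -sum_nat_const; apply: eq_bigr => u uD; apply: cE.
have cp : c z <= p by rewrite -(card_inn (iter k succ i) z) subset_leq_card // subsetIl.
(* A divisor of a power of [p] that is at most [p] is [1] (growth by the factor [p]) or [p] (no
   growth). *)
have /(dvdn_pfactor _ _ p_prime)[[|e] le_e ce] : c z %| p ^ k.+1 by rewrite -S dvdn_mull.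
  by left; rewrite -S ce muln1.
right; move: cp; rewrite ce -{2}(expn1 p) leq_exp2l ?prime_gt1 // ltnS leqn0 => /eqP e0.
move: S; rewrite ce e0 expn1 expnSr => /eqP; rewrite eqn_pmul2r // => /eqP //.
Qed.


Lemma card_descS k i x : #|desc A k.+1 i x| <= p * #|desc A k i x|.
Proof.
rewrite descSr mulnC -sum_nat_const.
rewrite (eq_bigr (fun y => #|outn A (iter k succ i) y|)) //.
elim/big_rec2: _ => [|y n B _ le]; first by rewrite cards0.
by rewrite (leq_trans (leq_card_setU _ _)) // leq_add2l.
Qed.

Lemma desc_onto k i z : exists x, z \in desc A k i x.
Proof.
elim: k z => [|k IH] z; first by exists z; rewrite inE.
have /card_gt0P[y] : 0 < #|inn (iter k succ i) z| by rewrite card_inn prime_gt0.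
rewrite inE => yz; have [x yx] := IH y; exists x.
by rewrite descSr; apply/bigcupP; exists y; rewrite ?inE.
Qed.

Lemma iter_succE k i : iter k succ i = (i + k%:Z)%R.
Proof.
elim: k => [|k IH]; first by rewrite GRing.addr0.
by rewrite iterS IH /succ -GRing.addrA -addn1 PoszD.
Qed.

(* The descendants of a vertex stop growing at some distance [b], where they
   number [p ^ b]; from then on an out-neighbour has the same descendants, and
   connectedness forces these to fill a whole level. *)
Lemma desc_full : layer_connected A ->
  exists b, [/\ 0 < b, p ^ b = m, (forall i x, desc A b i x = [set: 'I_m]) &
    forall k i x, k <= b -> #|desc A k i x| = p ^ k].
Proof.
move=> conn; have p_gt1 := prime_gt1 p_prime; have p_gt0 := prime_gt0 p_prime.
pose x0 := Ordinal m_gt0.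
pose Q k := #|desc A k 0%R x0| == p ^ k.
have exQ : exists k, Q k by exists 0; rewrite /Q /= cards1.
have ubQ k : Q k -> k <= m.
  move=> /eqP E; apply: ltnW; apply: leq_trans (ltn_expl k p_gt1) _.
  by rewrite -E -[X in _ <= X]card_ord max_card.
case: (ex_maxnP exQ ubQ) => b /eqP Qb bmax.
have cb i x : #|desc A b i x| = p ^ b by rewrite (card_desc hat _ _ _ 0%R x0).
have cb1 i x : #|desc A b.+1 i x| = p ^ b.
  case: (desc_growth (cb i x)) => // E.
  suff : Q b.+1 by move/bmax; rewrite ltnn.
  by rewrite /Q (card_desc hat _ _ _ i x) E.
have out_ex i x : exists y, A i x y.
  have /card_gt0P[w] : 0 < #|outn A i x| by rewrite out.
  by rewrite inE; exists w.
have step k i x y : b <= k -> A i x y -> desc A k.+1 i x = desc A k (succ i) y.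
  move=> /subnK <- xy; elim: (k - b) => [|n IH].
    by apply/esym/eqP; rewrite eqEcard desc_sub //= cb cb1.
  by rewrite addSn [RHS]descSr descSr IH iterSr.
have cstep k i x : b <= k -> #|desc A k i x| = p ^ b.
  move=> /subnK <-; elim: (k - b) i x => [|n IH] i x; first exact: cb.
  by have [y xy] := out_ex i x; rewrite (step _ _ _ y) ?leq_addl.
(* Vertices of level [l] whose descendants on some later level are those of [x0]. *)
pose U l := [set x | `[< exists K L, [/\ b <= K,
  iter K succ l = iter L succ 0%R & desc A K l x = desc A L 0%R x0] >]].
have UT : forall i x, x \in U i.
  apply: conn; last first.
    by exists 0%R, x0; rewrite inE; apply/asboolP; exists b, b.
  move=> i x y xy; rewrite !inE; apply/asboolP/asboolP.
    move=> [K [L [bK E D]]]; exists K, L.+1; split=> //.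
      by rewrite -iterSr !iterS E.
    by rewrite -(step _ _ x) // !descSr D E.
  move=> [K [L [bK E D]]]; exists K.+1, L; split; first exact: ltnW.
    by rewrite iterSr.
  by rewrite (step _ _ _ y).
have /choice[f fP] x : exists K, forall k, K <= k ->
    desc A k 0%R x = desc A k 0%R x0.
  have := UT 0%R x; rewrite inE => /asboolP[K [L [_ E D]]].
  have KL : K = L by move: E; rewrite !iter_succE => /GRing.addrI [].
  exists K => k /subnK <-; elim: (k - K) => [|n IH]; first by rewrite D KL.
  by rewrite addSn !descSr IH.
(* At distance [K] all vertices of level 0 have the same descendants, and together these cover the
   level. *)
pose K := b + \max_x f x.
have DK : desc A K 0%R x0 = [set: 'I_m].
  apply/setP=> z; have [x zx] := desc_onto K 0%R z.
  rewrite -(fP x) ?zx ?inE //; apply: leq_trans (leq_addl _ _).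
  exact: leq_bigmax.
have pbm : p ^ b = m by rewrite -(cstep K 0%R x0) ?leq_addr // DK cardsT card_ord.
exists b; split=> //.
- have : Q 1 by rewrite /Q desc1 out expn1.
  by move/bmax.
- by move=> i x; apply/eqP; rewrite eqEcard subsetT cb pbm cardsT card_ord /=.
(* Each step multiplies the count by at most [p], and [p ^ b] is attained after [b] steps, so no
   step falls short. *)
- move=> k i x /subnK kb; apply/eqP; rewrite eqn_leq; apply/andP; split.
    elim: k {kb} => [|k IH]; first by rewrite /= cards1.
    by rewrite (leq_trans (card_descS _ _ _)) // expnS leq_pmul2l.
  suff : p ^ b <= p ^ (b - k) * #|desc A k i x|.
    by rewrite -{1}kb expnD leq_pmul2l // expn_gt0 p_gt0.
  rewrite -{1}(cb i x) -{1}kb; elim: (b - k) => [|n IH].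
    by rewrite mul1n.
  by rewrite (leq_trans (card_descS _ _ _)) // expnS -mulnA leq_pmul2l.
Qed.

(** * The stabilizer of an arc *)

Section Stabilizer.
Context (k : nat) (i : int) (v : nat -> 'I_m).
Hypothesis arc_v : is_arc A k i v.

Local Notation T := ('I_k.+2 * 'I_m)%type.
Local Notation lev t := (iter t succ i).

(** [T] has one level more than [v] meets, which makes the action on the out-neighbours of [v k]
    visible. *)
Definition arc_stab := [set s : {perm T} | `[< exists tau sg,
  [/\ layer_aut A tau sg, tau i = i,
      forall t, t <= k -> sg (lev t) (v t) = v t &
      forall u : T, s u = (u.1, sg (lev u.1) u.2)] >]].

Lemma arc_stab_group_set : group_set arc_stab.
Proof.
apply/group_setP; split.
  rewrite inE; apply/asboolP; exists id, (fun=> id).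
  split=> // [|u]; first by split=> // j x y.
  by rewrite perm1 -surjective_pairing.
move=> s1 s2; rewrite !inE => /asboolP[t1 [g1 [aut1 t1i v1 E1]]].
move=> /asboolP[t2 [g2 [aut2 t2i v2 E2]]]; apply/asboolP.
have lt1 t : t1 (lev t) = lev t by rewrite (layer_aut_iter _ _ aut1) t1i.
exists (t2 \o t1), (fun j => g2 (t1 j) \o g1 j); split.
- exact: layer_aut_comp.
- by rewrite /= t1i.
- by move=> t tk; rewrite /= lt1 v1 ?v2.
- by move=> u; rewrite permM E1 E2 /= lt1.
Qed.
Canonical arc_stab_group := Group arc_stab_group_set.

Definition out_set t x := [set u : T | (u.1 == inord t.+1) && A (lev t) x u.2].

Lemma card_out_set t x : #|out_set t x| = p.
Proof.
have inj : injective (pair (inord t.+1 : 'I_k.+2) : 'I_m -> T) by move=> ? ? [].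
rewrite -(out (lev t) x) -(card_imset _ inj); apply: eq_card => -[j y].
rewrite inE /=; apply/andP/imsetP => [[/eqP-> xy]|[z]].
  by exists y; rewrite ?inE.
by rewrite inE => xz [-> ->].
Qed.

Lemma arc_stabP s : s \in arc_stab -> exists sg,
  [/\ forall t x, t <= k.+1 -> s (inord t, x) = (inord t, sg t x),
      forall t, t <= k -> sg t (v t) = v t,
      forall t x y, A (lev t) (sg t x) (sg t.+1 y) = A (lev t) x y &
      forall n t x z, z \in desc A n (lev t) x ->
        sg (n + t) z \in desc A n (lev t) (sg t x)].
Proof.
rewrite inE => /asboolP[tau [sg [aut ti vE sE]]].
have tl t : tau (lev t) = lev t by rewrite (layer_aut_iter _ _ aut) ti.
exists (fun t => sg (lev t)); split=> // [t x tk|t x y|n t x z zx].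
- by rewrite sE /= inordK.
- by case: aut => _ _ AE; rewrite -{1}tl /= AE.
- by rewrite -[X in desc _ _ X (sg _ _)]tl (desc_aut _ _ _ aut) iterD imset_f.
Qed.

(** Extending [v] by [y] and by [y'] gives two arcs of length [k.+1], to which high arc-transitivity
    applies. *)
Lemma arc_stab_last y y' : A (lev k) (v k) y -> A (lev k) (v k) y' ->
  exists2 s, s \in arc_stab & s (inord k.+1, y) = (inord k.+1, y').
Proof.
move=> vy vy'; pose ext z t := if t <= k then v t else z.
have ext_arc z : A (lev k) (v k) z -> is_arc A k.+1 i (ext z).
  move=> vz t; rewrite ltnS /ext => tk; rewrite tk; case: ltnP => [/arc_v//|kt].
  by have -> : t = k by apply/eqP; rewrite eqn_leq tk.
have [tau [sg [aut ti E]]] := hat (ext_arc _ vy) (ext_arc _ vy').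
pose f (u : T) : T := (u.1, sg (lev u.1) u.2).
have f_inj : injective f.
  move=> [a x] [b z] [/= ->].
  by case: aut => _ inj _ /inj ->.
exists (perm f_inj); last first.
  by rewrite permE /f /= inordK //; have := E k.+1 (leqnn _); rewrite /ext ltnn => ->.
rewrite inE; apply/asboolP; exists tau, sg; split=> // [t tk|u]; last by rewrite permE.
by have := E t (leqW tk); rewrite /ext tk.
Qed.

Section PSubgroup.
Context (P : {group {perm T}}).
Hypotheses (pP : (p.-group P)%g) (sP : P \subset arc_stab).

Definition pinned t x := forall s, s \in P -> s (inord t, x) = (inord t, x).

Lemma pinned_arc t : t <= k -> pinned t (v t).
Proof.
move=> tk s /(subsetP sP)/arc_stabP[sg [sE vE _ _]].
by rewrite sE ?vE // leqW.
Qed.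

Lemma acts_out_set t x : t <= k -> pinned t x -> [acts P, on out_set t x | 'P]%g.
Proof.
move=> tk px; apply/actsP=> s sP' [j y]; rewrite /= /aperm !inE.
have := px s sP'; have /(subsetP sP)/arc_stabP[sg [sE _ AE _]] := sP'.
rewrite sE 1?leqW // => -[sx].
have [->|nj] := eqVneq j (inord t.+1); first by rewrite sE //= eqxx -{1}sx AE.
have jE : j = inord (val j) by rewrite inord_val.
rewrite {1 2}jE sE; last by rewrite -ltnS ltn_ord.
by rewrite /= -jE (negPf nj).
Qed.

(** The number of fixed points of a [p]-group on [p] out-neighbours is divisible by [p], so one
    fixed point forces all. *)
Lemma pinned_out t x y y' : t <= k -> pinned t x ->
  A (lev t) x y -> pinned t.+1 y -> A (lev t) x y' -> pinned t.+1 y'.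
Proof.
move=> tk px xy py xy'; have := pgroup_fix_mod pP (acts_out_set tk px).
set F := 'Fix_(_ | _)(P)%g; rewrite card_out_set modnn => /esym/eqP F0.
have F_gt0 : 0 < #|F|.
  apply/card_gt0P; exists (inord t.+1, y); rewrite !inE /= eqxx xy /=.
  by apply/subsetP=> s /py sy; rewrite inE; apply/eqP.
have FE : F = out_set t x.
  by apply/eqP; rewrite eqEcard subsetIl card_out_set dvdn_leq.
have : (inord t.+1, y') \in F by rewrite FE inE /= eqxx.
rewrite inE => /andP[_ /afixP fy] s sP'; exact: fy.
Qed.

(** The orbit lies among the [p] out-neighbours of [x], and its size is a power of [p] other than
    [1]. *)
Lemma orbit_out t x y y' : t <= k -> pinned t x -> ~ pinned t.+1 y ->
  A (lev t) x y -> A (lev t) x y' ->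
  (inord t.+1, y') \in orbit 'P P (inord t.+1 : 'I_k.+2, y).
Proof.
move=> tk px npy xy xy'; set O := orbit _ _ _.
have inS z : A (lev t) x z -> (inord t.+1, z) \in out_set t x by rewrite inE /= eqxx.
have OS : O \subset out_set t x.
  by rewrite acts_sub_orbit ?inS // acts_out_set.
suff -> : O = out_set t x by apply: inS.
apply/eqP; rewrite eqEcard OS card_out_set.
have /p_natP[[|e] cO] : p.-nat #|O| by apply: pnat_dvd (dvdn_orbit _ _ _) pP.
  case: npy => s sP'; apply/eqP.
  have /cards1P[u OE] : #|O| == 1 by rewrite cO.
  have : (inord t.+1, y) \in O by apply: orbit_refl.
  have : s (inord t.+1, y) \in O by apply: (mem_orbit 'P).
  by rewrite OE !inE => /eqP-> /eqP->.
by rewrite cO expnS leq_pmulr // expn_gt0 prime_gt0.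
Qed.

End PSubgroup.

(** The out-neighbours of [v k] form a single orbit, of size [p], of the whole stabilizer. If [P]
    fixed one of them, [p] would divide the index of [P]. *)
Lemma sylow_moves (P : {group {perm T}}) : (p.-Sylow(arc_stab_group) P)%g ->
  exists2 y, A (lev k) (v k) y & ~ pinned P k.+1 y.
Proof.
move=> /and3P[sP pP p'].
have /card_gt0P[y] : 0 < #|outn A (lev k) (v k)| by rewrite out prime_gt0.
rewrite inE => vy; exists y => // py.
set u : T := (inord k.+1, y).
have stabP : P \subset 'C_arc_stab_group[u | 'P]%g.
  apply/subsetP=> s sP'; rewrite inE (subsetP sP) //.
  by apply/astab1P; apply: py.
have dv := indexgS arc_stab_group stabP.
have oE : orbit 'P arc_stab_group u = out_set k (v k).
  apply/eqP; rewrite eqEsubset acts_sub_orbit ?inE /= ?eqxx ?vy //; last first.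
    by apply: acts_out_set => //; apply: pinned_arc.
  apply/subsetP=> -[j y']; rewrite inE /= => /andP[/eqP-> vy'].
  by have [s sK <-] := arc_stab_last vy vy'; apply: (mem_orbit 'P).
by move: p'; rewrite p'natE // -(card_out_set k (v k)) -oE card_orbit dv.
Qed.

End Stabilizer.

(** * Uniqueness of arcs of length [b] and shared out-neighbourhoods *)

Section Full.
Context (b : nat).
Hypothesis b_gt0 : 0 < b.
Hypothesis full : forall i x, desc A b i x = [set: 'I_m].
Hypothesis cdesc : forall k i x, k <= b -> #|desc A k i x| = p ^ k.

(** The [p] out-neighbours of [x] have [p ^ k] descendants each, and the union has [p ^ k.+1]
    elements, so these sets are disjoint. *)
Lemma desc_inj k i x y y' z : k < b -> A i x y -> A i x y' ->
  z \in desc A k (succ i) y -> z \in desc A k (succ i) y' -> y = y'.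
Proof.
move=> kb xy xy' zy zy'; apply/eqP/negPn/negP=> yy'.
have := cdesc i x kb; rewrite /= (bigD1 y) ?inE //= => E.
set B := \bigcup_(_ in _ | _) _ in E.
have cB : #|B| <= p.-1 * p ^ k.
  have -> : p.-1 = #|outn A i x :\ y|.
    by rewrite -(out i x) (cardsD1 y (outn A i x)) inE xy.
  rewrite -sum_nat_const /B.
  rewrite (eq_bigl (mem (outn A i x :\ y))); last by move=> u; rewrite !inE andbC.
  rewrite (eq_bigr (fun u => #|desc A k (succ i) u|)); last first.
    by move=> u _; rewrite cdesc // ltnW.
  elim/big_rec2: _ => [|u n C _ le]; first by rewrite cards0.
  by rewrite (leq_trans (leq_card_setU _ _)) // leq_add2l.
have zB : z \in B.
  by apply/bigcupP; exists y' => //; rewrite inE xy' eq_sym.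
have I_gt0 : 0 < #|desc A k (succ i) y :&: B|.
  by apply/card_gt0P; exists z; rewrite inE zy.
have := cardsUI (desc A k (succ i) y) B; rewrite E (cdesc _ _ (ltnW kb)) => EQ.
have: p ^ k.+1 < p ^ k + #|B| by rewrite -EQ -[X in X < _]addn0 ltn_add2l.
rewrite ltnNge expnS -(prednK (prime_gt0 p_prime)) mulSn leq_add2l.
by rewrite prednK ?prime_gt0 // cB.
Qed.

(* A pinned vertex [x] of level [j] reaches the pinned vertex [v (j + b)] by a
   unique arc of length [b], so some out-neighbour of [x] is pinned; as they are
   [p] in number, they all are. *)
Lemma pinned_desc k i v (P : {group {perm 'I_k.+2 * 'I_m}}) j x :
  is_arc A k i v -> (p.-group P)%g -> P \subset arc_stab k i v ->
  j + b <= k.+1 -> x \in desc A j i (v 0) -> pinned P j x.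
Proof.
move=> av pP sP; elim: j x => [|j IH] x jk.
  by rewrite inE => /eqP-> ; apply: pinned_arc sP _ _.
rewrite descSr => /bigcupP[y yv]; rewrite inE => yx.
have py : pinned P j y by apply: IH => //; apply: ltnW.
have jk' : j + b <= k by rewrite -ltnS -addSn.
have jk1 : j < k.
  by apply: leq_trans jk'; rewrite -[X in X < _]addn0 ltn_add2l.
have : v (j + b) \in desc A b (iter j succ i) y by rewrite full inE.
rewrite -{2}(prednK b_gt0) descS => /bigcupP[u]; rewrite inE => yu wu.
suff pu : pinned P j.+1 u by apply: (pinned_out pP sP _ py yu pu); rewrite // ltnW.
move=> s sP'; have := py s sP'.
have /(subsetP sP)/arc_stabP[sg [sE vE AE DE]] := sP'.
rewrite !sE ?(leqW (ltnW jk1)) ?leqW // => -[sy]; congr pair.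
apply: (@desc_inj b.-1 (iter j succ i) y _ _ (v (j + b))) => //.
- by rewrite prednK.
- by rewrite -{1}sy AE.
- by have := DE _ j.+1 _ _ wu; rewrite addnS -addSn prednK // addnC vE.
Qed.

Lemma outn_shared i x x' y : A i x y -> A i x' y -> outn A i x = outn A i x'.
Proof.
(* By vertex-transitivity one vertex [z] whose in-neighbours all have the same out-neighbours is
   enough. *)
suff [l [z H]] : exists l z, forall u u' w, A l u z -> A l u' z ->
    A l u w -> A l u' w.
  have [tau [sg [aut tl zy]]] := vertex_trans hat (succ l) z (succ i) y.
  have {}tl : tau l = i.
    by case: (aut) => tS _ _; move: tl; rewrite tS /succ => /GRing.addIr.
  have [u ->] := layer_aut_surj l x aut; have [u' ->] := layer_aut_surj l x' aut.
  rewrite -zy -tl; case: (aut) => _ _ AE; rewrite !AE !outn_aut // => uz u'z.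
  suff -> : outn A l u = outn A l u' by [].
  by apply/setP=> w; rewrite !inE; apply/idP/idP; apply: H.
(* [2b - 1] is the least length for which [pinned_desc] applies to level [b], the first that is
   filled by descendants of [v 0]. *)
have [v av] : exists v, is_arc A (b + b.-1) i v.
  have /card_gt0P[w /desc_path[v [av _ _]]] : 0 < #|desc A (b + b.-1) i x|.
    elim: (b + b.-1) i x => [|k IH] l u; first by rewrite cards1.
    have /card_gt0P[w uw] : 0 < #|outn A l u| by rewrite out prime_gt0.
    apply: leq_trans (IH (succ l) w) (subset_leq_card _); apply: desc_sub.
    by rewrite inE in uw.
  by exists v.
set k := b + b.-1 in av; have kE : k.+1 = b + b by rewrite /k -addnS prednK.
have [P sylP] := Sylow_exists p (arc_stab_group k i v).
have [y0 vy0 npy0] := sylow_moves av sylP.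
case/and3P: sylP => sP pP _.
(* Level [b] is entirely pinned and level [k.+1] contains [y0], so somewhere between them a pinned
   level precedes one that is not. *)
have [t [tk pt [z npz]]] : exists t, [/\ t <= k, forall u, pinned P t u &
    exists z, ~ pinned P t.+1 z].
  apply: contrapT => nex; apply: npy0.
  suff H n u : b + n <= k.+1 -> pinned P (b + n) u by rewrite kE; apply: H; rewrite kE.
  elim: n u => [|n IH] u bn.
    by apply: (pinned_desc av pP sP); rewrite addn0 ?kE // full inE.
  apply: contrapT => npu; apply: nex; exists (b + n); split.
  - by rewrite -ltnS -addnS.
  - by move=> w; apply: IH; apply: ltnW; rewrite -addnS.
  - by exists u; rewrite -addnS.
exists (iter t succ i), z => u u' w uz u'z uw.
have := orbit_out pP sP tk (pt u) npz uz uw.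
(* [s] fixes [u'] and takes [z] to [w], so it takes the arc from [u'] to [z] to one from [u'] to
   [w]. *)
case/orbitP=> s sP'; rewrite /= /aperm.
have := pt u' s sP'; have /(subsetP sP)/arc_stabP[sg [sE _ AE _]] := sP'.
by rewrite !sE ?(leqW tk) // => -[su'] [<-]; rewrite -{1}su' AE.
Qed.

End Full.

End Growth.

(** * Identifying the vertices with the same out-neighbours *)

Definition layer_graph n (B : layers n) : digraph :=
  @Digraph (int * 'I_n) (fun a b => b.1 = succ a.1 /\ B a.1 a.2 b.2).

Lemma inj_onto_bij (T U : Type) (f : T -> U) :
  injective f -> (forall y, exists x, f x = y) -> bijective f.
Proof. by move=> inj /choice[g gK]; exists g => // x; apply: inj; rewrite gK. Qed.

Lemma succ_inj : injective succ. Proof. by move=> i j /GRing.addIr. Qed.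

Definition Pl_vertex (G : digraph) (x y : G) (xy : Defs.arc x y) : Pl G :=
  exist (fun a : G * G => Defs.arc a.1 a.2) (x, y) xy.

Section Quotient.
Context (m p : nat) (A : layers m).
Hypotheses (hat : layer_hat A) (out : forall i x, #|outn A i x| = p).
Hypotheses (p_prime : prime p) (m_gt0 : 0 < m).
Hypothesis shared : forall i x x' y,
  A i x y -> A i x' y -> outn A i x = outn A i x'.

(** By [shared], a class consists of all in-neighbours of any of its out-neighbours, hence has [p]
    elements. All levels thus have equally many classes, so a single type ['I_m'] can number
    them. *)
Lemma quotient_map : exists m' (q : int -> 'I_m -> 'I_m'),
  [/\ p * m' = m, forall i x x', q i x = q i x' <-> outn A i x = outn A i x' &
      forall i c, exists x, q i x = c].
Proof.
pose C i := [set outn A i x | x : 'I_m].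
have cC i : p * #|C i| = m.
  rewrite -[RHS]card_ord -[RHS]sum1_card.
  rewrite [RHS](partition_big_imset (outn A i)) /=.
  rewrite mulnC -sum_nat_const; apply: eq_bigr => _ /imsetP[x _ ->].
  have /card_gt0P[y] : 0 < #|outn A i x| by rewrite out prime_gt0.
  rewrite inE => xy; rewrite -(card_inn hat out m_gt0 i y) -sum1_card.
  apply: eq_bigl => z; rewrite !inE; apply/idP/eqP => [zy|E]; first exact: shared zy xy.
  by have : y \in outn A i z; [rewrite E inE | rewrite inE].
have p_gt0 := prime_gt0 p_prime.
have cC0 i : #|C i| = #|C 0%R|.
  by apply/eqP; rewrite -(eqn_pmul2l p_gt0) !cC.
have /choice[q qP] i : exists q : 'I_m -> 'I_#|C 0%R|,
    (forall x x', q x = q x' <-> outn A i x = outn A i x') /\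
    forall c, exists x, q x = c.
  have inC x : outn A i x \in C i by apply: imset_f.
  have C0 := inC (Ordinal m_gt0).
  exists (fun x => cast_ord (cC0 i) (enum_rank_in C0 (outn A i x))).
  split=> [x x'|c].
    split=> [/cast_ord_inj E|-> //].
    by have := congr1 enum_val E; rewrite !enum_rankK_in.
  have /imsetP[x _ xE] := enum_valP (cast_ord (esym (cC0 i)) c).
  by exists x; rewrite -xE enum_valK_in cast_ordKV.
exists #|C 0%R|, q; split=> // i; first by case: (qP i).
by case: (qP i).
Qed.

Context (m' : nat) (q : int -> 'I_m -> 'I_m').
Hypothesis qE : forall i x x', q i x = q i x' <-> outn A i x = outn A i x'.
Hypothesis q_onto : forall i c, exists x, q i x = c.

Definition quotient : layers m' := fun i c d =>
  [exists x, exists y, [&& q i x == c, A i x y & q (succ i) y == d]].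

(** Any representative of the source class serves, since its members have the same
    out-neighbours. *)
Lemma quotientP i x d :
  reflect (exists2 y, A i x y & q (succ i) y = d) (quotient i (q i x) d).
Proof.
apply: (iffP existsP) => [[x' /existsP[y /and3P[/eqP xx' xy /eqP yd]]]|[y xy yd]].
  exists y => //; have : y \in outn A i x' by rewrite inE.
  by move/qE: xx' => ->; rewrite inE.
by exists x; apply/existsP; exists y; rewrite eqxx xy yd /=.
Qed.

Lemma quotient_connected : layer_connected A -> layer_connected quotient.
Proof.
move=> conn U clU [i [c cU]] j d; have [x xd] := q_onto j d; rewrite -xd.
suff : x \in [set x | q j x \in U j] by rewrite inE.
apply: (conn (fun j => [set x | q j x \in U j])).
  move=> l y z yz; rewrite !inE; apply: clU.
  by apply/quotientP; exists z.
by have [y yc] := q_onto i c; exists i, y; rewrite inE yc.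
Qed.

(** The lift is extended one vertex at a time: whichever representative was chosen has an
    out-neighbour in the next class. *)
Lemma lift_arc k i c : is_arc quotient k i c ->
  exists v, is_arc A k i v /\ forall t, t <= k -> q (iter t succ i) (v t) = c t.
Proof.
elim: k => [|k IH] ac.
  have [x xc] := q_onto i (c 0); exists (fun=> x); split=> // t.
  by rewrite leqn0 => /eqP->.
have [|v [av vE]] := IH; first by move=> t tk; apply: ac; apply: ltnW.
have /quotientP[y vy yc] : quotient (iter k succ i) (q (iter k succ i) (v k)) (c k.+1).
  by rewrite vE // ac.
exists (fun t => if t <= k then v t else y); split=> t.
  rewrite ltnS => tk; rewrite tk; case: ltnP => [/av//|kt].
  by have -> : t = k by apply/eqP; rewrite eqn_leq tk.
rewrite leq_eqVlt ltnS; case: leqP => [tk _|tk]; first exact: vE.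
by rewrite orbF => /eqP->.
Qed.

Lemma quotient_hat : layer_hat quotient.
Proof.
move=> k i j c d /lift_arc[v [av vc]] /lift_arc[w [aw wd]].
have [tau [sg [aut ti sE]]] := hat av aw.
(* Automorphisms respect equality of out-neighbourhoods, hence act on classes. *)
have sq l x x' : q l x = q l x' <-> q (tau l) (sg l x) = q (tau l) (sg l x').
  rewrite !qE !outn_aut //; split=> [-> //|].
  by apply: imset_inj; case: aut.
have /choice[g gP] l : exists g : 'I_m' -> 'I_m',
    forall x, g (q l x) = q (tau l) (sg l x).
  have /choice[r rP] := q_onto l.
  by exists (fun c => q (tau l) (sg l (r c))) => x; apply/(sq l); rewrite rP.
exists tau, g; split=> // [|t tk]; last first.
  by rewrite -vc // gP sE // (layer_aut_iter _ _ aut) ti wd.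
split=> [|l a b|l a b]; first by case: aut.
  have [x <-] := q_onto l a; have [y <-] := q_onto l b.
  by rewrite !gP => /(sq l).
have [x <-] := q_onto l a; have [y <-] := q_onto (succ l) b.
have [tS _ AE] := aut; rewrite !gP tS.
apply/quotientP/quotientP => -[z].
  have [u ->] := layer_aut_surj (succ l) z aut; rewrite AE -tS => xu /(sq (succ l)) uy.
  by exists u.
by move=> xz zy; exists (sg (succ l) z); rewrite ?AE // -tS; apply/(sq (succ l)).
Qed.

Hypothesis q_inj : forall i x y y', A i x y -> A i x y' ->
  q (succ i) y = q (succ i) y' -> y = y'.

Lemma card_outn_quotient i c : #|outn quotient i c| = p.
Proof.
have [x <-] := q_onto i c; rewrite -(out i x).
have -> : outn quotient i (q i x) = q (succ i) @: outn A i x.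
  apply/setP=> d; rewrite inE; apply/quotientP/imsetP => [[y xy <-]|[y]].
    by exists y; rewrite ?inE.
  by rewrite inE => xy ->; exists y.
by apply: card_in_imset => y y'; rewrite !inE; apply: q_inj.
Qed.

(* A vertex is identified with the arc of the quotient that goes from the
   common class of its in-neighbours to its own class. *)
Lemma quotient_Pl : isomorphic (layer_graph A) (Pl (layer_graph quotient)).
Proof.
have /choice[f fP] (u : layer_graph A) :
    exists a : Pl (layer_graph quotient), exists i x,
    [/\ u.1 = succ i, A i x u.2 & sval a = ((i, q i x), (u.1, q u.1 u.2))].
  case: u => j y; pose i := (j - 1)%R.
  have ij : j = succ i by rewrite /succ GRing.subrK.
  have /card_gt0P[x] : 0 < #|inn A i y| by rewrite (card_inn hat out m_gt0) prime_gt0.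
  rewrite inE => xy.
  have a_arc : Defs.arc ((i, q i x) : layer_graph quotient) (j, q j y).
    by split=> //=; apply/quotientP; exists y; rewrite -?ij.
  by exists (Pl_vertex a_arc), i, x.
have f_arc u v : Defs.arc u v <-> Defs.arc (f u) (f v).
  have [i [x [iE xu fu]]] := fP u; have [j [y [jE yv fv]]] := fP v.
  rewrite /= fu fv /=; split.
    move=> [vu uv]; have uj : u.1 = j by apply: succ_inj; rewrite -vu.
    rewrite uj; congr pair; apply/qE; apply: shared yv.
    by rewrite -uj.
  move=> [uj]; rewrite uj => /qE E; split=> //=.
  by have : v.2 \in outn A j u.2; [rewrite E inE | rewrite inE].
exists f; split=> //; apply: inj_onto_bij => [u v E|[[[i c] [j d]] ij]].
  have [i [x [iE xu fu]]] := fP u; have [l [y [lE yv fv]]] := fP v.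
  move: fu; rewrite E fv => -[li qE' uv]; rewrite uv; subst l.
  move: xu yv; rewrite [u]surjective_pairing [v]surjective_pairing -uv /= => xu yv q2.
  congr pair; move/qE: qE' => E'.
  (* [x] and [y] are in one class, so [u] and [v] are out-neighbours of [x] in one class, and
     [q_inj] applies. *)
  have xv : A i x v.2 by have : v.2 \in outn A i x; [rewrite -E' inE | rewrite inE].
  by apply: (q_inj xu xv); rewrite -lE.
have [ji cd] : j = succ i /\ quotient i c d := ij; have [x xc] := q_onto i c.
rewrite -xc in cd; have /quotientP[y xy yd] := cd.
exists (j, y); have [l [z [lE zy fy]]] := fP (j, y).
have {}lE : l = i by apply: succ_inj; rewrite -lE.
move: zy fy; rewrite lE /= => zy; case: (f _) => a a_arc /= aE.
apply: eq_exist => /=; rewrite aE; congr ((_, _), (_, _)).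
  by rewrite -xc; apply/qE; apply: shared zy xy.
by rewrite ji.
Qed.

End Quotient.

(** * Classification of layered digraphs *)

Lemma isomorphic_trans (G H K : digraph) :
  isomorphic G H -> isomorphic H K -> isomorphic G K.
Proof.
move=> [f [bf fE]] [g [bg gE]]; exists (g \o f); split; first exact: bij_comp.
by move=> x y; rewrite fE gE.
Qed.

Lemma isomorphic_Pl (G H : digraph) : isomorphic G H -> isomorphic (Pl G) (Pl H).
Proof.
move=> [f [bf fE]]; have [g fK gK] := bf.
exists (fun a : Pl G => Pl_vertex ((fE (sval a).1 (sval a).2).1 (svalP a))); split; last first.
  move=> [[x y] xy] [[z w] zw] /=; split=> [->//|].
  exact: (bij_inj bf).
apply: inj_onto_bij => [[[x y] xy] [[z w] zw] /(congr1 sval)/= [xz yw]|[[x y] xy]].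
  by apply: eq_exist; congr pair; apply: (bij_inj bf).
have xy' : Defs.arc (g x) (g y) by apply/fE; rewrite !gK.
by exists (Pl_vertex xy'); apply: eq_exist; rewrite /= !gK.
Qed.

Lemma layer_classification m p (A : layers m) : prime p -> 0 < m ->
  layer_hat A -> (forall i x, #|outn A i x| = p) -> layer_connected A ->
  exists r, p ^ r.+1 = m /\ isomorphic (layer_graph A) (iter r Pl (Delta p)).
Proof.
move=> p_prime; elim/ltn_ind: m A => m IH A m_gt0 hat out conn.
have [b [b_gt0 pbm full cdesc]] := desc_full hat out p_prime m_gt0 conn.
have shared := outn_shared hat out p_prime b_gt0 full cdesc.
have [b1|b_neq1] := eqVneq b 1.
  (* Now [m = p] and consecutive levels are completely joined, so the identity is an isomorphism to
     [Delta p]. *)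
  rewrite b1 expn1 in pbm; subst m; exists 0; split=> //.
  exists id; split; first by exists id.
  move=> x y; split=> [[]//|xy]; split=> //=.
  by have := full x.1 x.2; rewrite b1 desc1 => /setP/(_ y.2); rewrite !inE.
have b_gt1 : 1 < b by rewrite ltn_neqAle eq_sym b_neq1.
have [m' [q [pm' qE q_onto]]] := quotient_map hat out p_prime m_gt0 shared.
(* Out-neighbours of [x] in one class share a descendant at distance [1]; as [1 < b], [desc_inj]
   identifies them. *)
have q_inj i x y y' : A i x y -> A i x y' ->
    q (succ i) y = q (succ i) y' -> y = y'.
  move=> xy xy' /qE E.
  have /card_gt0P[z zy] : 0 < #|outn A (succ i) y| by rewrite out prime_gt0.
  by apply: (desc_inj out p_prime cdesc b_gt1 xy xy' (z := z)); rewrite desc1 -?E.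
have m'_gt0 : 0 < m' by move: m_gt0; rewrite -pm' muln_gt0 => /andP[].
have lt_m' : m' < m by rewrite -pm' ltn_Pmull // prime_gt1.
have [r [prm iso]] := IH _ lt_m' (quotient A q) m'_gt0
  (quotient_hat hat qE q_onto) (card_outn_quotient out qE q_onto q_inj)
  (quotient_connected qE q_onto conn).
exists r.+1; split; first by rewrite expnS prm.
apply: isomorphic_trans (isomorphic_Pl iso).
exact: (quotient_Pl hat out p_prime m_gt0 shared qE q_onto q_inj).
Qed.

(* From the digraph to its layers *)
From mathcomp Require Import all_classical.
Local Open Scope classical_set_scope.
Local Open Scope card_scope.

(** The displacement of the level is the same at both ends of an arc, hence constant by
    connectedness. *)
Lemma aut_shift (G : digraph) (phi : G -> vecZ) (g : G -> G) :
  connected G -> is_hom phi -> is_automorphism g ->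
  forall x y, (phi (g x) - phi x = phi (g y) - phi y :> int)%R.
Proof.
move=> conn hom [_ gE] x y; have [n [w [[adj _] <- <-]]] := conn x y.
have step u v : Defs.arc u v ->
    (phi (g u) - phi u = phi (g v) - phi v :> int)%R.
  move=> uv; have -> : phi v = (phi u + 1)%R := hom _ _ uv.
  have -> : phi (g v) = (phi (g u) + 1)%R := hom _ _ ((gE _ _).1 uv).
  by rewrite GRing.opprD GRing.addrACA GRing.subrr GRing.addr0.
elim: n adj => // n IH adj; rewrite IH; last by move=> i lt_in; apply/adj/ltnW.
by case: (adj n (ltnSn n)) => /step.
Qed.

Lemma layering (G : digraph) (p m : nat) (phi : G -> vecZ) :
  connected G -> highly_arc_transitive G -> out_valency G p -> is_hom phi ->
  (forall i : vecZ, phi @^-1` [set i] #= `I_m) ->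
  exists A : layers m, [/\ layer_hat A, forall i x, #|outn A i x| = p,
    layer_connected A & isomorphic G (layer_graph A)].
Proof.
move=> conn hat out hom fibres.
(* [f i] numbers the fibre over [i] by ['I_m]. *)
have /choice[f fP] (i : int) : exists f : 'I_m -> G,
    [/\ injective f, forall x, phi (f x) = i & forall v, phi v = i -> exists x, f x = v].
  have /card_set_bijP[h [h_lt h_inj h_onto]] := fibres i.
  have /choice[f fP] (x : 'I_m) : exists v, phi v = i /\ h v = x.
    by have [v /= vi vx] := h_onto x (ltn_ord x); exists v.
  exists f; split=> [x y E|x|v vi]; last 1 first.
  - have v_lt : h v < m := h_lt v vi.
    exists (Ordinal v_lt); apply: h_inj; rewrite ?inE //=.
      by case: (fP (Ordinal v_lt)).
    by case: (fP (Ordinal v_lt)).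
  - by apply: ord_inj; rewrite -(fP x).2 E (fP y).2.
  - by case: (fP x).
have f_inj i : injective (f i) by case: (fP i).
have phif i x : phi (f i x) = i by case: (fP i).
have f_onto v : exists x, f (phi v) x = v by case: (fP (phi v)) => _ _; apply.
pose A : layers m := fun i x y => `[< Defs.arc (f i x) (f (succ i) y) >].
have AE i x y : A i x y <-> Defs.arc (f i x) (f (succ i) y).
  by split=> /asboolP.
exists A; split.
- move=> k i j v w av aw.
  have [||g gaut gE] := hat k (fun t => f (iter t succ i) (v t))
    (fun t => f (iter t succ j) (w t)).
  - by move=> t tk; apply/AE/av.
  - by move=> t tk; apply/AE/aw.
  (* The displacement of [g], read off at the start of the arc. *)
  pose s : int := (j - i)%R.
  have gs u : phi (g u) = (phi u + s)%R.
    have := aut_shift conn hom gaut u (f i (v 0)).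
    rewrite (gE 0) //= !phif => /(congr1 (fun z => z + phi u)%R).
    by rewrite GRing.subrK GRing.addrC.
  have /choice[sg sgP] l : exists h : 'I_m -> 'I_m,
      forall x, f (l + s)%R (h x) = g (f l x).
    have /choice[h hP] x : exists y, f (l + s)%R y = g (f l x).
      by have [y] := f_onto (g (f l x)); rewrite gs phif; exists y.
    by exists h.
  have shE t : (iter t succ i + s = iter t succ j)%R.
    elim: t => [|t IH] /=; first by rewrite /s GRing.addrC GRing.subrK.
    by rewrite -IH /succ GRing.addrAC.
  exists (fun l => l + s)%R, sg; split.
  + split=> [l|l x y E|l x y]; first by rewrite /succ GRing.addrAC.
      have [/bij_inj ginj _] := gaut.
      by apply: (f_inj l); apply: ginj; rewrite -!sgP E.
    have yE : f (succ (l + s)%R) (sg (succ l) y) = g (f (succ l) y).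
      by rewrite -sgP /succ GRing.addrAC.
    apply/idP/idP => /AE xy; apply/AE; move: xy; rewrite sgP yE.
      exact: (gaut.2 _ _).2.
    exact: (gaut.2 _ _).1.
  + by rewrite /s GRing.addrC GRing.subrK.
  + move=> t tk; apply: (f_inj (iter t succ i + s)%R).
    by rewrite sgP gE // shE.
- move=> i x; have /card_set_bijP[h [h_lt h_inj h_onto]] := out (f i x).
  have arc_lev y : y \in outn A i x -> Defs.arc (f i x) (f (succ i) y).
    by rewrite finset.inE => /AE.
  pose k y := h (f (succ i) y).
  have k_lt y : y \in outn A i x -> k y < p by move=> /arc_lev/h_lt.
  have k_inj : {in outn A i x &, injective k}.
    move=> y z /arc_lev xy /arc_lev xz E; apply: (f_inj (succ i)).
    by apply: h_inj; rewrite ?inE.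
  have k_onto j : j < p -> exists2 y, y \in outn A i x & k y = j.
    move=> jp; have [v /= xv vj] := h_onto j jp.
    have vi : phi v = succ i by rewrite -(phif i x); apply: hom xv.
    have [y yv] := f_onto v; exists y; last by rewrite /k -vi yv.
    by rewrite finset.inE; apply/AE; rewrite -vi yv.
  (* The values of [k] on [outn A i x] are [0, ..., p - 1], each taken once. *)
  rewrite -(size_iota 0 p) cardE -(size_map k); apply: perm_size.
  apply: uniq_perm; rewrite ?iota_uniq //.
    rewrite map_inj_in_uniq ?enum_uniq // => y z; rewrite !mem_enum.
    exact: k_inj.
  move=> j; rewrite mem_iota /=; apply/mapP/idP => [[y]|/k_onto[y yx <-]].
    by rewrite mem_enum => /k_lt + ->.
  by exists y; rewrite ?mem_enum.
- move=> U clU [i [x xU]] j y.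
  (* [U] carried over to [G], to be propagated along an undirected path. *)
  pose V u := exists2 z, z \in U (phi u) & f (phi u) z = u.
  have Vf l z : V (f l z) <-> z \in U l.
    by rewrite /V phif; split=> [[z' z'U /f_inj <-]//|zU]; exists z.
  have clV u v : Defs.arc u v -> V u <-> V v.
    move=> uv; have [a au] := f_onto u; have [c cv] := f_onto v.
    have vu : phi v = succ (phi u) := hom _ _ uv.
    rewrite -au -cv !Vf vu (clU (phi u) a c) //.
    by apply/AE; rewrite -vu au cv.
  apply/Vf; have [n [w [[adj _] w0 <-]]] := conn (f i x) (f j y).
  elim: n adj {w0} (etrans w0 erefl : w 0 = f i x) => [|n IH] adj w0.
    by rewrite w0; apply/Vf.
  have Vn : V (w n) by apply: IH => // l ln; apply/adj/ltnW.
  by case: (adj n (ltnSn n)) => /clV; [move=> <-|move=> ->].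
- have /choice[r rP] := f_onto.
  exists (fun u => (phi u, r u)); split.
    apply: inj_onto_bij => [u v [uv E]|[i x]].
      by rewrite -(rP u) -(rP v) uv E.
    exists (f i x); congr pair; first exact: phif.
    by apply: (f_inj i); have := rP (f i x); rewrite phif.
  move=> u v /=; split=> [uv|[vu /AE]]; last by rewrite -vu !rP.
  have vu : phi v = succ (phi u) := hom _ _ uv.
  by split=> //; apply/AE; rewrite -vu !rP.
Qed.

Theorem corollary16 (G : digraph) (p m : nat) (phi : G -> vecZ)
  (two_ended_G : two_ended G)
  (hat_G : highly_arc_transitive G)
  (p_prime : prime p)
  (out_val_p : out_valency G p)
  (phi_hom : is_hom phi)
  (phi_surj : forall i : vecZ, exists v : G, phi v = i)
  (fibres : forall i : vecZ, phi @^-1` [set i] #= `I_m)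
  (m_gt2 : 2 < m) :
  exists r : nat, p ^ r.+1 = m /\ isomorphic G (iter r Pl (Delta p)).
Proof.
have [A [hat out conn iso]] := layering two_ended_G.1 hat_G out_val_p phi_hom fibres.
have [r [prm isoA]] := layer_classification p_prime (ltnW (ltnW m_gt2)) hat out conn.
by exists r; split=> //; apply: isomorphic_trans isoA.
Qed.
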